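(* Let $l\in\{0,1\}$. Suppose the randomized classifiers $\{Q_i\}$ have the form $Q_i(x)=g(x,\mathcal{D},\xi_i)$ (for all $x\in\mathcal{X}$) with $g$ deterministic and $\xi_1,\xi_2,\dots$ i.i.d. and independent of $\mathcal{D}$. Suppose also that for each $l'\in\{0,1\}$ the conditional distribution $\mathcal{L}(\theta(X)\mid\mathcal{D},Y=l')$ has a density $f_{l'}$ on $[0,1]$ that is Lipschitz in a neighborhood of $1/2$. Then, as $t\to\infty$ along odd integers, $$\mathbb{E}[\mathrm{Err}_{t,l}\mid\mathcal{D}]=\mathrm{err}_{\infty,l}+\mathcal{O}\big(\tfrac1t\big).$$ Furthermore, if $f_l$ is also differentiable at $1/2$, then as $t\to\infty$ along odd integers, $$\mathbb{E}[\mathrm{Err}_{t,l}\mid\mathcal{D}]=\mathrm{err}_{\infty,l}+\frac{1}{8t}\,f_l'(\tfrac12)+o\big(\tfrac1t\big).$$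
   Context: $\mathcal{X}$ is a generic sample space; $\mathcal{D}=\{(X_j,Y_j)\}_{j=1}^n$ is a training set in $\mathcal{X}\times\{0,1\}$, which is held fixed (all expectations are conditional on $\mathcal{D}$, and $\mathcal{O}(\cdot)$, $o(\cdot)$ terms may depend on $\mathcal{D}$). $(X,Y)$ is a random test point in $\mathcal{X}\times\{0,1\}$, independent of $\mathcal{D}$ and of $\xi_1,\xi_2,\dots$; $\mu_l:=\mathcal{L}(X\mid Y=l)$ is the distribution of $X$ given $Y=l$. The classifiers are random functions $Q_i:\mathcal{X}\to\{0,1\}$, $\bar Q_t(x):=\frac1t\sum_{i=1}^tQ_i(x)$, and $t$ is odd. The class-wise error rate of the majority vote is the random variable $$\mathrm{Err}_{t,l}:=\int_{\mathcal{X}}1\{|\bar Q_t(x)-l|\ge\tfrac12\}\,d\mu_l(x).$$ Define $\theta:\mathcal{X}\to[0,1]$ by $\theta(x):=\mathbb{E}[Q_1(x)\mid\mathcal{D}]$, the expectation being over $\xi_1$ with $x$ and $\mathcal{D}$ fixed. With $F_l$ the cumulative distribution function of the density $f_l$, the limiting error rates are $\mathrm{err}_{\infty,0}:=1-F_0(\tfrac12)$ and $\mathrm{err}_{\infty,1}:=F_1(\tfrac12)$. A function $q:[0,1]\to\mathbb{R}$ is Lipschitz in a neighborhood of $1/2$ if there are constants $\kappa,\delta>0$ with $|q(s)-q(s')|\le\kappa|s-s'|$ for all $s,s'\in[1/2-\delta,1/2+\delta]$.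
   Formalization: The sign of the second-order term is corrected for l=0: the formal term is (-1)^{l+1} f_l'(1/2)/(8t), since the stated + sign fails for l=0 (e.g. θ(x)=x, f_0(s)=2s gives 3/4 − 1/(4(t+2))); D is fixed, g(·,D,·) jointly measurable and P(Y=l')>0. *)

(* Defs.v *)
From HB Require Import structures.
From mathcomp Require Import all_boot all_order all_algebra finmap.
From mathcomp Require Import all_classical all_reals all_analysis.

Set Implicit Arguments.
Unset Strict Implicit.
Unset Printing Implicit Defensive.

Import Order.TTheory GRing.Theory Num.Theory.
Import numFieldNormedType.Exports.

Local Open Scope classical_set_scope.
Local Open Scope ring_scope.

Section independence.
Context {dO dE : measure_display} {Omega : measurableType dO}
  {E : measurableType dE} {R : realType}.
Variable P : probability Omega R.
Local Open Scope ereal_scope.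

Definition mutually_independent (xi : nat -> Omega -> E) :=
  forall (I : {fset nat}) (B : nat -> set E), (forall i, measurable (B i)) ->
    P (\bigcap_(i in [set` I]) (xi i @^-1` B i)) =
    \prod_(i <- I) P (xi i @^-1` B i).

Definition identically_distributed (xi : nat -> {mfun Omega >-> E}) :=
  forall (i j : nat) (B : set E), measurable B ->
    distribution P (xi i) B = distribution P (xi j) B.

Definition iid (xi : nat -> {mfun Omega >-> E}) :=
  mutually_independent xi /\ identically_distributed xi.

(* Finite-dimensional cylinders form a pi-system generating sigma(xi), so this
   is independence of Z from the whole sequence xi. *)
Definition independent_of_sequence {dZ : measure_display}
    {T : measurableType dZ} (Z : Omega -> T) (xi : nat -> Omega -> E) :=
  forall (A : set T) (I : {fset nat}) (B : nat -> set E),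
    measurable A -> (forall i, measurable (B i)) ->
    P ((Z @^-1` A) `&` \bigcap_(i in [set` I]) (xi i @^-1` B i)) =
    P (Z @^-1` A) * P (\bigcap_(i in [set` I]) (xi i @^-1` B i)).

End independence.

(* The law of Z given Y = l, meaningful when P (Y = l) > 0. *)
Definition cond_law {dO dT : measure_display} {Omega : measurableType dO}
    {T : measurableType dT} {R : realType} (P : probability Omega R)
    (Y : {mfun Omega >-> bool}) (l : bool) (Z : Omega -> T) (A : set T)
    : \bar R :=
  ((fine (P (Y @^-1` [set l])))^-1%:E *
   P ((Z @^-1` A) `&` (Y @^-1` [set l])))%E.

Section cond_law_measure.
Context {dO dT : measure_display} {Omega : measurableType dO}
  {T : measurableType dT} {R : realType} (P : probability Omega R)
  (Y : {mfun Omega >-> bool}) (l : bool) (Z : {mfun Omega >-> T}).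

Let k := (fine (P (Y @^-1` [set l])))^-1.

Let k_ge0 : (0 <= k)%R.
Proof. by rewrite invr_ge0 fine_ge0. Qed.

Let mYl : measurable (Y @^-1` [set l]).
Proof. by rewrite -[X in measurable X]setTI; exact: measurable_funP. Qed.

Let m := mscale (NngNum k_ge0) (mrestr P mYl).

Let cond_lawE : cond_law P Y l Z = pushforward m Z.
Proof. by apply/funext => A. Qed.

Let cond_law0 : cond_law P Y l Z set0 = 0%E.
Proof. by rewrite cond_lawE /pushforward preimage_set0; exact: (measure0 m). Qed.

Let cond_law_ge0 A : (0 <= cond_law P Y l Z A)%E.
Proof. by rewrite cond_lawE; exact: (measure_ge0 m). Qed.

Let cond_law_sigma_additive : semi_sigma_additive (cond_law P Y l Z).
Proof. by rewrite cond_lawE; exact: measure_semi_sigma_additive. Qed.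

HB.instance Definition _ := isMeasure.Build _ _ _ (cond_law P Y l Z)
  cond_law0 cond_law_ge0 cond_law_sigma_additive.

End cond_law_measure.

Section density.
Context {R : realType}.
Implicit Types (nu : set R -> \bar R) (f : R -> R).

(* Only the values of f on [0, 1] are used; the law nu then vanishes outside
   [0, 1]. *)
Definition has_density_on_unit_interval nu f :=
  [/\ measurable_fun `[(0 : R), 1] f,
      (forall s, 0 <= s <= 1 -> 0 <= f s) &
      forall A : set R, measurable A ->
        nu A = (\int[lebesgue_measure]_(s in A `&` `[0%R, 1%R]) (f s)%:E)%E].

Definition cdf_of_density f (s : R) : R :=
  \int[lebesgue_measure]_(u in `]-oo, s] `&` `[0, 1]) f u.

Definition lipschitz_near_half f :=
  exists kappa delta : R, [/\ 0 < kappa, 0 < delta &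
    forall s s' : R,
      s \in `[1 / 2 - delta, 1 / 2 + delta] ->
      s' \in `[1 / 2 - delta, 1 / 2 + delta] ->
      `|f s - f s'| <= kappa * `|s - s'|].

(* With U the median of t independent uniform variables on [0, 1] (t odd), the
   expected error of the vote is E[F_1(U)] in class 1 and 1 - E[F_0(U)] in class
   0, where E U = 1/2 and Var U = 1 / (4 (t + 2)). The 1/t term of the error is
   thus + f_1'(1/2) / (8 t) in class 1 and - f_0'(1/2) / (8 t) in class 0. *)
Definition err_infty (f : bool -> R -> R) (l : bool) : R :=
  if l then cdf_of_density (f true) (1 / 2)
  else 1 - cdf_of_density (f false) (1 / 2).

End density.

(* The classifiers are numbered from 0, so Q_1, ..., Q_t are Q 0, ..., Q t.-1;
   class labels are booleans, mapped to 0 and 1 by b%:R. *)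
Section voting.
Context {dO dX : measure_display} {Omega : measurableType dO}
  {X : measurableType dX} {R : realType}.
Variables (P : probability Omega R) (Q : nat -> X -> Omega -> bool).

Definition Qbar (t : nat) (x : X) (w : Omega) : R :=
  t%:R^-1 * \sum_(i < t) (Q i x w)%:R.

Definition theta (x : X) : R := fine 'E_P[fun w => (Q 0 x w)%:R].

Definition Err (mu : {measure set X -> \bar R}) (t : nat) (l : bool)
    (w : Omega) : R :=
  \int[mu]_x \1_[set x' | 1 / 2 <= `|Qbar t x' w - l%:R|] x.

End voting.

(* t --> +oo along the odd integers. *)
Definition odd_infty : set_system nat := within [set t | odd t] \oo.

Instance odd_infty_filter : Filter odd_infty.
Proof. exact: within_filter. Qed.

(* Main.v *)
Require Import Defs.
From HB Require Import structures.
From mathcomp Require Import all_boot all_order all_algebra finmap.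
From mathcomp Require Import all_classical all_reals all_analysis.
From mathcomp Require Import measurable_realfun.
From mathcomp Require Import ring lra zify.

Set Implicit Arguments.
Unset Strict Implicit.
Unset Printing Implicit Defensive.

Import Order.TTheory GRing.Theory Num.Theory.
Import numFieldNormedType.Exports.

Local Open Scope classical_set_scope.
Local Open Scope ring_scope.

(** For a test point x the votes are independent and equal to 1 with
    probability p = theta x, so the majority is 1 with probability b_t(p), where
    b_t is the binomial upper tail [majority t]. Averaging over the test point
    (Fubini, [expected_Err]) and passing to the density of theta(X)
    ([integral_density]) turns the expected error into the integral of
    b_t f_0 over [0, 1] in class 0, and into 1 minus that of b_t f_1 in class 1.
    As b_t converges to the indicator of s > 1/2, whose integral against f_l
    gives the limiting error, the whole question is the size of the integral of
    D_t f_l, where D_t = b_t - 1{s > 1/2} is the [deviation]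
    ([expected_Err_deviation]).

    For odd t, b_t is also the distribution function of the median of t
    independent uniform variables. This suggests the four properties of D_t that
    are used: its integral is 0 by symmetry; its integral against s - 1/2 is
    -1/(8(t+2)), half the variance of the median up to sign; it has the sign of
    1/2 - s; and it is at most 2 / (t u^2)^2 at distance u from 1/2, hence
    O(1/t^2) away from 1/2.

    Suppose that f stays within k |s - 1/2| of f(1/2) + c (s - 1/2) near 1/2.
    The constant contributes nothing to the integral of D_t f and the slope
    contributes -c/(8(t+2)). Because D_t(s) (s - 1/2) does not change sign, the
    integral of its absolute value is 1/(8(t+2)) too, so the remainder costs at
    most k/(8(t+2)), plus O(1/t^2) from the points far from 1/2
    ([Rintegral_deviation_approx]). Taking c = 0 and k a Lipschitz constant gives
    the O(1/t) statement; taking c = f'(1/2) and k arbitrarily small gives the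
    first-order expansion. *)

(** * Binomial majorities *)

Section majority.
Context {R : realType}.
Implicit Types (t k : nat) (p s : R).

(** The upper tail, above t/2, of the binomial law of parameters t and p. *)
Definition majority t p : R :=
  \sum_(k < t.+1 | (t < k.*2)%N) 'C(t, k)%:R * (p ^+ k * (1 - p) ^+ (t - k)).

Lemma majority_ge0 t p : 0 <= p <= 1 -> 0 <= majority t p.
Proof.
move=> /andP[p0 p1]; apply: sumr_ge0 => k _.
by rewrite mulr_ge0// mulr_ge0// exprn_ge0// subr_ge0.
Qed.

(** Exchanging the two candidates; oddness of t excludes ties. *)
Lemma majority_onem t p : odd t -> majority t (1 - p) = 1 - majority t p.
Proof.
move=> ot; apply/eqP; rewrite eq_sym subr_eq; apply/eqP.
rewrite -[X in X = _](expr1n R t) -[X in X ^+ t](subrK p 1).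
rewrite exprDn (bigID (fun k : 'I_t.+1 => (t < k.*2)%N)) /= [LHS]addrC.
congr (_ + _); last first.
  by rewrite /majority; apply: eq_bigr => k _; rewrite mulr_natl mulrC.
rewrite /majority [RHS](reindex_inj rev_ord_inj)/=.
apply: eq_big => k; first by have := ltn_ord k; lia.
have kt : (k <= t)%N by rewrite -ltnS.
by move=> _; rewrite subSS (subKn kt) (subKr 1 p) bin_sub// mulr_natl.
Qed.

(** For p at most 1/2 and k > t/2, a term p^k (1-p)^(t-k) is at most
    (p (1-p))^m with t = 2m+1, because the excess of k over m sits on the smaller
    factor; the binomial coefficients then contribute at most 2^t. *)
Lemma majority_le t p : odd t -> 0 <= p <= 1 / 2 ->
  majority t p <= 2 * (4 * (p * (1 - p))) ^+ t./2.
Proof.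
move=> ot /andP[p0 p2].
have q0 : 0 <= 1 - p by lra.
have tE : t = (t./2).*2.+1 by lia.
have key (k : 'I_t.+1) : (t < k.*2)%N ->
    p ^+ k * (1 - p) ^+ (t - k) <= (p * (1 - p)) ^+ t./2.
  move=> tk; have kt : (k <= t)%N by rewrite -ltnS.
  have -> : (k : nat) = (t./2 + (k - t./2).-1.+1)%N by lia.
  set j := (k - t./2).-1.
  have -> : (t - (t./2 + j.+1) = t./2 - j)%N by lia.
  have jt : (j <= t./2)%N by rewrite /j; lia.
  rewrite exprMn exprD -mulrA ler_wpM2l ?exprn_ge0//.
  rewrite -[in leRHS](subnK jt) exprD mulrC ler_wpM2l ?exprn_ge0//.
  apply: (@le_trans _ _ (p ^+ j)).
    by apply: ler_wiXn2l => //; lra.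
  by apply: lerXn2r; rewrite ?nnegrE//; lra.
(* The factor 2 * 4 ^ t./2 is 2 ^ t, the sum of all binomial coefficients. *)
have sumC : 2 ^+ t = \sum_(k < t.+1) 'C(t, k)%:R :> R.
  rewrite -[2]/(1 + 1) exprDn; apply: eq_bigr => k _.
  by rewrite !expr1n mulr1.
rewrite exprMn mulrA (_ : 2 * 4 ^+ t./2 = 2 ^+ t); last first.
  by rewrite [in RHS]tE exprS -mul2n exprM; congr (_ * _ ^+ _); ring.
rewrite sumC mulr_suml [leRHS](bigID (fun k : 'I_t.+1 => (t < k.*2)%N))/=.
rewrite /majority ler_wpDr//.
  by apply: sumr_ge0 => k _; rewrite mulr_ge0// exprn_ge0// mulr_ge0.
by apply: ler_sum => k tk; rewrite ler_wpM2l// key.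
Qed.

(** With p = 1/2 - u the bound above is 2 (1 - 4u^2)^m, and
    (1 - 4u^2)^m <= (1 - 2u^2)^(2m) <= (1 + 2u^2)^(-2m) <= (1 + 2mu^2)^(-2) by
    the Bernoulli inequality. *)
Lemma majority_tail t p : odd t -> 0 <= p <= 1 / 2 ->
  majority t p * (t%:R * (p - 1 / 2) ^+ 2) ^+ 2 <= 2.
Proof.
move=> ot pI; have /andP[p0 p2] := pI.
set m := t./2; set v := (p - 1 / 2) ^+ 2.
have v0 : 0 <= v by exact: sqr_ge0.
have v4 : v <= 1 / 4 by rewrite /v; nra.
have vE : 4 * (p * (1 - p)) = 1 - 4 * v by rewrite /v; field.
have a0 : 0 <= (1 - 2 * v) ^+ m by apply: exprn_ge0; lra.
have tE : t%:R = 2 * m%:R + 1 :> R.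
  by rewrite -natrM natr1; congr _%:R; rewrite /m; lia.
have bern : t%:R * v <= (1 + 2 * v) ^+ m.
  have : 1 + m%:R * (2 * v) <= (1 + 2 * v) ^+ m.
    elim: m {a0 tE} => [|m IH]; first by rewrite expr0; lra.
    rewrite exprS -natr1; have m0 : 0 <= m%:R :> R by [].
    by nra.
  by rewrite tE; nra.
have ab : (1 - 2 * v) ^+ m * (1 + 2 * v) ^+ m <= 1.
  by rewrite -exprMn; apply: exprn_ile1; nra.
have maj : majority t p <= 2 * ((1 - 2 * v) ^+ m) ^+ 2.
  apply: (le_trans (majority_le ot pI)); rewrite ler_pM2l// vE.
  by rewrite exprAC -/m; apply: lerXn2r; rewrite ?nnegrE; nra.
have tv0 : 0 <= t%:R * v by rewrite mulr_ge0.
have av : (1 - 2 * v) ^+ m * (t%:R * v) <= 1.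
  by apply: le_trans ab; rewrite ler_wpM2l.
apply: (@le_trans _ _ (2 * ((1 - 2 * v) ^+ m * (t%:R * v)) ^+ 2)).
  by rewrite [in leRHS]exprMn [leRHS]mulrA ler_wpM2r// exprn_ge0.
by rewrite -[leRHS]mulr1 ler_pM2l// exprn_ile1// mulr_ge0.
Qed.

Lemma sum_majority (F : nat -> R) m :
  \sum_(k < m.*2.+2 | (m.*2.+1 < k.*2)%N) F k = \sum_(j < m.+1) F (m.+1 + j)%N.
Proof.
rewrite [LHS](_ : _ = \sum_(m.+1 <= k < m.*2.+2) F k).
  rewrite -{1}[m.+1]add0n big_addn big_mkord.
  have -> : (m.*2.+2 - m.+1 = m.+1)%N by lia.
  by apply: eq_bigr => k _; rewrite addnC.
rewrite [RHS](@big_nat_widenl _ _ _ _ 0)// [RHS]big_mkord.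
by apply: eq_bigl => k; lia.
Qed.

End majority.

(** * Moments of binomial majorities *)

Section integrals.
Context {R : realType}.
Notation mu := (@lebesgue_measure R).
Local Notation I01 := `[(0 : R), 1]%classic.
Implicit Types (t : nat) (s : R) (f h : R -> R).

Lemma bounded_integrable01 M h : measurable_fun I01 h ->
  (forall s, 0 <= s <= 1 -> `|h s| <= M) -> mu.-integrable I01 (EFin \o h).
Proof.
move=> mh hM; apply: measurable_bounded_integrable => //=.
  by rewrite lebesgue_measure_itv/= lte_fin ltr01 -EFinB ltry.
exists M; split; first exact: num_real.
move=> x Mx s /=; rewrite in_itv/= => s01.
by rewrite (le_trans (hM _ s01))// ltW.
Qed.

Lemma bounded_mul_integrable01 M h f : measurable_fun I01 h ->
  (forall s, 0 <= s <= 1 -> `|h s| <= M) -> mu.-integrable I01 (EFin \o f) ->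
  mu.-integrable I01 (EFin \o (fun s => h s * f s)).
Proof.
move=> mh hM If.
have -> : EFin \o (fun s => h s * f s) = ((EFin \o h) \* (EFin \o f))%E.
  by apply/funext => s /=; rewrite EFinM.
apply: integrableMr => //; exists M; split; first exact: num_real.
move=> x Mx s /=; rewrite in_itv/= => s01.
by rewrite (le_trans (hM _ s01))// ltW.
Qed.

Lemma integrable01Z (k : R) f : mu.-integrable I01 (EFin \o f) ->
  mu.-integrable I01 (EFin \o (fun s => k * f s)).
Proof.
move=> If; have -> : EFin \o (fun s => k * f s) = (fun s => k%:E * (f s)%:E)%E.
  by apply/funext => s /=; rewrite EFinM.
exact: integrableZl.
Qed.

Lemma integrable01D f h : mu.-integrable I01 (EFin \o f) ->
  mu.-integrable I01 (EFin \o h) ->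
  mu.-integrable I01 (EFin \o (fun s => f s + h s)).
Proof.
move=> If Ih.
have -> : EFin \o (fun s => f s + h s) = ((EFin \o f) \+ (EFin \o h))%E.
  by apply/funext => s /=; rewrite EFinD.
exact: integrableD.
Qed.

Lemma integrable01B f h : mu.-integrable I01 (EFin \o f) ->
  mu.-integrable I01 (EFin \o h) ->
  mu.-integrable I01 (EFin \o (fun s => f s - h s)).
Proof.
move=> If Ih.
have -> : EFin \o (fun s => f s - h s) = ((EFin \o f) \- (EFin \o h))%E.
  by apply/funext => s /=; rewrite EFinB.
exact: integrableB.
Qed.

Lemma Rintegral_powers (a b : nat) :
  \int[mu]_(s in I01) (s ^+ a * (1 - s) ^+ b) =
  (a`! * b`!)%:R / (a + b).+1`!%:R :> R.
Proof. by rewrite -beta_fun_fact /beta_fun -Rintegral_mkcond. Qed.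

Lemma measurable_majority t (A : set R) : measurable_fun A (majority t).
Proof.
rewrite /majority.
under eq_fun do rewrite -big_filter.
apply: measurable_sum => k; apply: measurable_funM => //.
exact: (@measurable_XMonemX R A k (t - k)).
Qed.

Lemma majority_le1 t s : odd t -> 0 <= s <= 1 -> majority t s <= 1.
Proof.
move=> ot /andP[s0 s1]; rewrite -subr_ge0 -majority_onem//.
by apply: majority_ge0; lra.
Qed.

(** Each term is a Beta integral. *)
Lemma Rintegral_majority_moment (j t : nat) :
  \int[mu]_(s in I01) (s ^+ j * majority t s) =
  \sum_(k < t.+1 | (t < k.*2)%N)
     'C(t, k)%:R * ((j + k)`! * (t - k)`!)%:R / (j + t).+1`!%:R.
Proof.
have Ipow (k : 'I_t.+1) : mu.-integrable I01
    (EFin \o (fun s => s ^+ (j + k) * (1 - s) ^+ (t - k))).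
  exact: integrable_XMonemX.
have IZ (k : 'I_t.+1) : mu.-integrable I01
    (fun s => ('C(t, k)%:R * (s ^+ (j + k) * (1 - s) ^+ (t - k)))%:E).
  exact: (integrable01Z _ (Ipow k)).
rewrite /Rintegral.
under eq_integral => s _.
  rewrite (_ : s ^+ j * majority t s = \sum_(k < t.+1 | (t < k.*2)%N)
    'C(t, k)%:R * (s ^+ (j + k) * (1 - s) ^+ (t - k))); last first.
    rewrite /majority mulr_sumr; apply: eq_bigr => k _.
    by rewrite exprD mulrCA !mulrA.
  rewrite -sumEFin; over.
rewrite integral_sum//=.
rewrite (eq_bigr (fun k : 'I_t.+1 => ('C(t, k)%:R *
    ((j + k)`! * (t - k)`!)%:R / (j + t).+1`!%:R)%:E)) ?sumEFin// => k _.
have kt : (k <= t)%N by rewrite -ltnS.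
rewrite -[LHS]fineK; last exact: integrable_fin_num.
rewrite -/(Rintegral _ _ _) RintegralZl// Rintegral_powers mulrA.
by rewrite -addnA subnKC.
Qed.

(** All t + 1 terms of the binomial expansion have the same Beta integral
    1/(t+1), and a majority keeps half of them. *)
Lemma Rintegral_majority t : odd t ->
  \int[mu]_(s in I01) majority t s = 1 / 2 :> R.
Proof.
move=> ot.
have -> : \int[mu]_(s in I01) majority t s =
          \int[mu]_(s in I01) (s ^+ 0 * majority t s).
  by apply: eq_Rintegral => s _; rewrite expr0 mul1r.
rewrite Rintegral_majority_moment.
transitivity (\sum_(k < t.+1 | (t < k.*2)%N) (t.+1%:R^-1 : R)).
  apply: eq_bigr => k _; have kt : (k <= t)%N by rewrite -ltnS.
  rewrite !add0n -natrM bin_fact// factS natrM.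
  by field; rewrite nat1r !pnatr_eq0 -!lt0n fact_gt0.
have {ot}[m ->] : exists m, t = m.*2.+1 by exists t./2; lia.
rewrite (sum_majority (fun=> m.*2.+2%:R^-1 : R)) sumr_const card_ord -mulr_natl.
rewrite (_ : m.*2.+2 = 2 * m.+1)%N ?natrM; last lia.
by field; rewrite nat1r pnatr_eq0.
Qed.

(** The k-th term now contributes (k+1)/((t+1)(t+2)). The value is the mean of
    (1 - U^2)/2 for the median U, whose second moment is 1/4 + 1/(4(t+2)). *)
Lemma Rintegral_id_majority t : odd t ->
  \int[mu]_(s in I01) (s * majority t s) = 3 / 8 - 1 / (8 * (t%:R + 2)) :> R.
Proof.
move=> ot.
have -> : \int[mu]_(s in I01) (s * majority t s) =
          \int[mu]_(s in I01) (s ^+ 1 * majority t s).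
  by apply: eq_Rintegral => s _; rewrite expr1.
rewrite Rintegral_majority_moment.
transitivity (\sum_(k < t.+1 | (t < k.*2)%N)
    (k.+1%:R / (t.+2 * t.+1)%:R : R)).
  apply: eq_bigr => k _; have kt : (k <= t)%N by rewrite -ltnS.
  have bf : t`!%:R = 'C(t, k)%:R * (k`! * (t - k)`!)%:R :> R.
    by rewrite -natrM bin_fact.
  rewrite !add1n (factS k) -(mulnA k.+1) (natrM _ k.+1) mulrCA -bf.
  rewrite !factS !natrM.
  by field; rewrite nat1r -(natrD _ 2 t) !pnatr_eq0 -!lt0n fact_gt0.
have sumS m : \sum_(j < m.+1) ((m.+1 + j).+1%:R : R) =
    (m.+1)%:R * (3 * m%:R + 4) / 2.
  under eq_bigr do rewrite -addSn natrD.
  rewrite big_split/= sumr_const card_ord -mulr_natl.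
  have -> : \sum_(j < m.+1) (j%:R : R) = m%:R * m.+1%:R / 2.
    elim: m => [|m IH]; first by rewrite big_ord1 !mul0r.
    by rewrite big_ord_recr/= IH -!natr1; field.
  by rewrite -!natr1; field.
have {ot}[m ->] : exists m, t = m.*2.+1 by exists t./2; lia.
rewrite -mulr_suml (sum_majority (fun k => k.+1%:R)) sumS.
rewrite natrM -!natr1 -mul2n natrM; field.
by rewrite !gt_eqF//; have : 0 <= m%:R :> R by []; lra.
Qed.

Lemma Rintegral_centered (a : R) : a < 1 ->
  \int[mu]_(s in `[a, 1]) (s - a) = (1 - a) ^+ 2 / 2.
Proof.
move=> a1; rewrite /Rintegral.
pose F : R -> R := 2^-1 *: (id - cst a) ^+ 2.
have FE s : F s = (s - a) ^+ 2 / 2 by rewrite [RHS]mulrC.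
have dF s : is_derive s (1 : R) F (s - a).
  apply: is_derive_eq.
  rewrite subr0 /GRing.scale/= expr1 mulr1 -mulr_natr -[(id - cst a) s]/(s - a).
  by field.
have cF s : {for s, continuous F}.
  by apply: differentiable_continuous; apply/derivable1_diffP; case: (dF s).
rewrite (@continuous_FTC2 _ _ F)//=.
- by rewrite !FE subrr expr0n/= mul0r subr0.
- apply: continuous_subspaceT => s.
  by apply: cvgB; [exact: cvg_id|exact: cvg_cst].
- split.
  + by move=> s _; case: (dF s).
  + exact/cvg_at_right_filter/cF.
  + exact/cvg_at_left_filter/cF.
- by move=> s _; rewrite derive1E; case: (dF s).
Qed.

End integrals.

(** * Deviation from the step function *)

Section deviation.
Context {R : realType}.
Notation mu := (@lebesgue_measure R).
Local Notation I01 := `[(0 : R), 1]%classic.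
Implicit Types (t : nat) (s : R) (f h : R -> R).

Definition deviation t s : R := majority t s - (1 / 2 < s)%R%:R.

Lemma deviation_le_half t s : s <= 1 / 2 -> deviation t s = majority t s.
Proof. by rewrite /deviation ltNge => ->; rewrite subr0. Qed.

Lemma deviation_gt_half t s : odd t -> 1 / 2 < s ->
  deviation t s = - majority t (1 - s).
Proof. by move=> ot s2; rewrite /deviation s2 majority_onem// opprB. Qed.

(** The deviation is nonnegative up to 1/2 and nonpositive beyond. *)
Lemma deviation_sign t s : odd t -> 0 <= s <= 1 ->
  `|deviation t s| * `|s - 1 / 2| = deviation t s * (1 / 2 - s).
Proof.
move=> ot /andP[s0 s1]; have [s2|s2] := leP s (1 / 2).
  rewrite deviation_le_half// ger0_norm ?ler0_norm ?opprB//; first by lra.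
  by apply: majority_ge0; lra.
rewrite deviation_gt_half// normrN ger0_norm ?gtr0_norm; [by ring|lra|].
by apply: majority_ge0; lra.
Qed.

Lemma deviation_tail t s : odd t -> 0 <= s <= 1 ->
  `|deviation t s| * (t%:R * (s - 1 / 2) ^+ 2) ^+ 2 <= 2.
Proof.
move=> ot /andP[s0 s1]; have [s2|s2] := leP s (1 / 2).
  rewrite deviation_le_half// ger0_norm; last by apply: majority_ge0; lra.
  by apply: majority_tail => //; lra.
rewrite deviation_gt_half// normrN ger0_norm; last by apply: majority_ge0; lra.
have -> : (s - 1 / 2) ^+ 2 = (1 - s - 1 / 2) ^+ 2 by field.
by apply: majority_tail => //; lra.
Qed.

Lemma deviation_le1 t s : odd t -> 0 <= s <= 1 -> `|deviation t s| <= 1.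
Proof.
move=> ot /andP[s0 s1]; have [s2|s2] := leP s (1 / 2).
  rewrite deviation_le_half// ger0_norm; last by apply: majority_ge0; lra.
  by apply: majority_le1 => //; lra.
rewrite deviation_gt_half// normrN ger0_norm; last by apply: majority_ge0; lra.
by apply: majority_le1 => //; lra.
Qed.

Lemma measurable_above_half (A : set R) :
  measurable_fun A (fun s => (1 / 2 < s)%R%:R : R).
Proof.
have -> : (fun s => (1 / 2 < s)%R%:R : R) = \1_`]1 / 2, +oo[.
  by apply/funext => s; rewrite indicE mem_setE in_itv/= andbT.
exact: measurable_indic.
Qed.

Lemma measurable_deviation t (A : set R) : measurable_fun A (deviation t).
Proof.
apply: measurable_funB; first exact: measurable_majority.
exact: measurable_above_half.
Qed.

Lemma integrable_deviation_mul t f : odd t -> mu.-integrable I01 (EFin \o f) ->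
  mu.-integrable I01 (EFin \o (fun s => deviation t s * f s)).
Proof.
move=> ot; apply: (@bounded_mul_integrable01 _ 1).
  exact: measurable_deviation.
by move=> s; exact: deviation_le1.
Qed.

Lemma integrable_majority_mul t f : odd t -> mu.-integrable I01 (EFin \o f) ->
  mu.-integrable I01 (EFin \o (fun s => majority t s * f s)).
Proof.
move=> ot; apply: (@bounded_mul_integrable01 _ 1).
  exact: measurable_majority.
by move=> s s01; rewrite ger0_norm ?majority_le1// majority_ge0.
Qed.

Lemma integrable_above_half_mul f : mu.-integrable I01 (EFin \o f) ->
  mu.-integrable I01 (EFin \o (fun s => (1 / 2 < s)%R%:R * f s)).
Proof.
apply: (@bounded_mul_integrable01 _ 1); first exact: measurable_above_half.
by move=> s _; case: (1 / 2 < s); rewrite ?normr1 ?normr0.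
Qed.

Lemma Rintegral_above_half f : mu.-integrable I01 (EFin \o f) ->
  \int[mu]_(s in I01) ((1 / 2 < s)%R%:R * f s) =
  \int[mu]_(s in `[1 / 2, 1]) f s.
Proof.
move=> If; rewrite -[RHS]Rintegral_itv_obnd_cbnd; last first.
  apply: integrableS If => //=.
  by move=> s /=; rewrite !in_itv/=; lra.
have -> : `]1 / 2, 1]%classic = I01 `&` `]1 / 2, +oo[.
  by apply/seteqP; split => s /=; rewrite !in_itv/=; lra.
rewrite Rintegral_mkcondr; apply: eq_Rintegral => s _.
rewrite patchE mem_setE in_itv/= andbT.
by case: (1 / 2 < s); rewrite ?mul1r ?mul0r.
Qed.

Lemma Rintegral_deviation_mul t f : odd t -> mu.-integrable I01 (EFin \o f) ->
  \int[mu]_(s in I01) (deviation t s * f s) =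
  \int[mu]_(s in I01) (majority t s * f s) - \int[mu]_(s in `[1 / 2, 1]) f s.
Proof.
move=> ot If; rewrite -Rintegral_above_half// -RintegralB//.
- by apply: eq_Rintegral => s _; rewrite mulrBl.
- exact: integrable_majority_mul.
- exact: integrable_above_half_mul.
Qed.

Lemma integrable01_cst (c : R) : mu.-integrable I01 (EFin \o cst c).
Proof. by apply: (@bounded_integrable01 _ `|c|). Qed.

Lemma integrable01_id : mu.-integrable I01 (EFin \o id).
Proof.
apply: (@bounded_integrable01 _ 1) => // s /andP[s0 s1].
by rewrite ger0_norm.
Qed.

Lemma Rintegral_deviation t : odd t ->
  \int[mu]_(s in I01) deviation t s = 0.
Proof.
move=> ot.
have -> : \int[mu]_(s in I01) deviation t s =
          \int[mu]_(s in I01) (deviation t s * 1).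
  by apply: eq_Rintegral => s _; rewrite mulr1.
rewrite (Rintegral_deviation_mul ot (integrable01_cst 1)).
under eq_Rintegral do rewrite mulr1.
rewrite Rintegral_majority// Rintegral_cst//= lebesgue_measure_itv/=.
by rewrite lte_fin ifT /=; [field|lra].
Qed.

Lemma Rintegral_deviation_id t : odd t ->
  \int[mu]_(s in I01) (deviation t s * (s - 1 / 2)) = - (8 * (t%:R + 2))^-1.
Proof.
move=> ot.
have I1 := integrable01_cst (1 / 2).
have Ic : mu.-integrable I01 (EFin \o (fun s => s - 1 / 2)).
  exact: (integrable01B integrable01_id I1).
rewrite Rintegral_deviation_mul// Rintegral_centered//; last by lra.
have -> : \int[mu]_(s in I01) (majority t s * (s - 1 / 2)) =
    \int[mu]_(s in I01) (s * majority t s - majority t s * (1 / 2)).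
  by apply: eq_Rintegral => s _; ring.
have Im : mu.-integrable I01 (EFin \o majority t).
  apply: (@bounded_integrable01 _ 1); first exact: measurable_majority.
  by move=> s s01; rewrite ger0_norm ?majority_le1// majority_ge0.
rewrite RintegralB//.
- rewrite Rintegral_id_majority// RintegralZr// Rintegral_majority//.
  by field; rewrite -(natrD _ t 2) addn2 pnatr_eq0.
- apply: (@bounded_mul_integrable01 _ 1) => // s /andP[s0 s1].
  by rewrite ger0_norm.
- exact: (integrable_majority_mul ot I1).
Qed.

(** The deviation acts like 1/(8(t+2)) times the derivative of a point mass at
    1/2. Near 1/2 the remainder is weighted by |D_t(s)| |s - 1/2|, whose integral
    is known exactly because D_t has a constant sign on each side of 1/2;
    elsewhere the tail bound of D_t applies. *)
Lemma Rintegral_deviation_approx t f (c k d : R) : odd t -> 0 <= k -> 0 < d ->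
  mu.-integrable I01 (EFin \o f) ->
  (forall s, 0 <= s <= 1 -> `|s - 1 / 2| <= d ->
    `|f s - f (1 / 2) - c * (s - 1 / 2)| <= k * `|s - 1 / 2|) ->
  `|\int[mu]_(s in I01) (deviation t s * f s) + c * (8 * (t%:R + 2))^-1| <=
  k * (8 * (t%:R + 2))^-1 + 2 / (t%:R * d ^+ 2) ^+ 2 *
    \int[mu]_(s in I01) `|f s - f (1 / 2) - c * (s - 1 / 2)|.
Proof.
move=> ot k0 d0 If fk.
pose r s := f s - f (1 / 2) - c * (s - 1 / 2).
have Ic : mu.-integrable I01 (EFin \o (fun s => s - 1 / 2)).
  exact: (integrable01B integrable01_id (integrable01_cst (1 / 2))).
have Icc := integrable01Z c Ic.
have If1 := integrable01B If (integrable01_cst (f (1 / 2))).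
have Ir : mu.-integrable I01 (EFin \o r) by exact: (integrable01B If1 Icc).
have Idr := integrable_deviation_mul ot Ir.
have Idc := integrable_deviation_mul ot Ic.
have Id1 : mu.-integrable I01 (EFin \o deviation t).
  apply: (@bounded_integrable01 _ 1); first exact: measurable_deviation.
  by move=> s; exact: deviation_le1.
have -> : \int[mu]_(s in I01) (deviation t s * f s) =
    \int[mu]_(s in I01) (deviation t s * r s) - c * (8 * (t%:R + 2))^-1.
  transitivity (\int[mu]_(s in I01) (deviation t s * r s +
      (f (1 / 2) * deviation t s + c * (deviation t s * (s - 1 / 2))))).
    by apply: eq_Rintegral => s _; rewrite /r; ring.
  rewrite RintegralD//; last first.
    exact: (integrable01D (integrable01Z _ Id1) (integrable01Z c Idc)).
  rewrite RintegralD//; last 2 first.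
    exact: (integrable01Z _ Id1).
    exact: (integrable01Z c Idc).
  rewrite RintegralZl// RintegralZl// Rintegral_deviation//.
  by rewrite Rintegral_deviation_id// mulr0 add0r mulrN.
rewrite subrK; apply: (le_trans (le_normr_Rintegral _ Idr)) => //.
have Inr := integrable_norm Ir.
set e := 2 / (t%:R * d ^+ 2) ^+ 2.
have t0 : 0 < t%:R :> R by rewrite ltr0n; case: (t) ot.
(* - D_t(s) (s - 1/2) is |D_t(s)| |s - 1/2|, so the first summand bounds the
   part within d of 1/2 and the second one the rest. *)
apply: (@le_trans _ _ (\int[mu]_(s in I01)
    ((- k) * (deviation t s * (s - 1 / 2)) + e * `|r s|))).
  apply: le_Rintegral => //.
  - exact: (integrable_norm Idr).
  - exact: (integrable01D (integrable01Z (- k) Idc) (integrable01Z e Inr)).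
  - move=> s /=; rewrite in_itv/= => s01; rewrite normrM.
    have -> : - k * (deviation t s * (s - 1 / 2)) =
              k * (`|deviation t s| * `|s - 1 / 2|).
      by rewrite deviation_sign//; ring.
    have [sd|sd] := leP `|s - 1 / 2| d.
      rewrite -[leLHS]addr0 lerD//; last first.
        by rewrite mulr_ge0// divr_ge0// sqr_ge0.
      by rewrite mulrCA ler_wpM2l// fk.
    rewrite -[leLHS]add0r lerD//; first by rewrite !mulr_ge0.
    rewrite ler_wpM2r// /e ler_pdivlMr; last first.
      by rewrite exprn_gt0// mulr_gt0// exprn_gt0.
    apply: le_trans (deviation_tail ot s01).
    have sd2 : d ^+ 2 <= (s - 1 / 2) ^+ 2.
      rewrite -[leRHS]real_normK ?num_real//.
      by apply: lerXn2r; rewrite ?nnegrE// ltW.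
    rewrite ler_wpM2l//; apply: lerXn2r.
    + by rewrite nnegrE mulr_ge0// sqr_ge0.
    + by rewrite nnegrE mulr_ge0// sqr_ge0.
    + by rewrite ler_pM2l.
rewrite RintegralD//; last 2 first.
  exact: (integrable01Z (- k) Idc).
  exact: (integrable01Z e Inr).
rewrite RintegralZl// RintegralZl// Rintegral_deviation_id//.
by rewrite mulrNN.
Qed.

End deviation.

(** * The law of the vote count *)

Section vote_count.
Context {dO dE : measure_display} {Omega : measurableType dO}
  {E : measurableType dE} {R : realType}.
Variables (P : probability Omega R) (xi : nat -> {mfun Omega >-> E}).
Hypothesis xi_iid : iid P xi.
Variable A : set E.
Hypothesis mA : measurable A.

Let p : R := fine (P (xi 0%N @^-1` A)).

Let prob_in i : P (xi i @^-1` A) = p%:E.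
Proof.
rewrite /p fineK ?fin_num_measure//; first exact: (xi_iid.2 i 0%N _ mA).
by rewrite -[X in measurable X]setTI; exact: measurable_funP.
Qed.

Let prob_out i : P (xi i @^-1` ~` A) = (1 - p)%:E.
Proof.
rewrite preimage_setC probability_setC ?prob_in ?EFinB//.
by rewrite -[X in measurable X]setTI; exact: measurable_funP.
Qed.

Let votes t (w : Omega) : {set 'I_t} :=
  finset (fun i : 'I_t => `[< A (xi i w) >]).

(** Mutual independence speaks of one constraint per index of the sequence, so
    the set S of voters is prescribed vote by vote, with no constraint from
    index t on. *)
Let ballot t (S : {set 'I_t}) (i : nat) : set E :=
  if insub i is Some j then (if j \in S then A else ~` A) else setT.

Let votesE t (S : {set 'I_t}) : votes t @^-1` [set S] =
  \bigcap_(i in [set` [fset x in iota 0 t]%fset]) (xi i @^-1` ballot S i).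
Proof.
apply/seteqP; split => w /=.
  move=> <- i /=; rewrite !inE mem_iota add0n => /= it.
  rewrite /ballot -[i]/(val (Ordinal it)) valK inE/=.
  by case: asboolP.
move=> H; apply/setP => i; rewrite inE.
have := H i; rewrite /= !inE mem_iota add0n ltn_ord => /(_ isT).
rewrite /ballot (valK i).
by case: (i \in S) => ?; apply/asboolP.
Qed.

Let measurable_ballot t (S : {set 'I_t}) i : measurable (ballot S i).
Proof.
rewrite /ballot; case: insub => // j; case: ifP => // _; exact: measurableC.
Qed.

Let prob_votes t (S : {set 'I_t}) :
  P (votes t @^-1` [set S]) = (p ^+ #|S| * (1 - p) ^+ (t - #|S|))%:E.
Proof.
rewrite votesE xi_iid.1; last exact: measurable_ballot.
rewrite (perm_big (iota 0 t)); last first.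
  by apply: uniq_perm; rewrite ?fset_uniq ?iota_uniq// => i; rewrite !inE.
rewrite -[X in iota 0 X]subn0 big_mkord.
rewrite (eq_bigr (fun i : 'I_t => (if i \in S then p else 1 - p)%:E));
    last first.
  move=> i _; rewrite /ballot (valK i).
  by case: ifP.
rewrite prodEFin (bigID (mem S))/=; congr (_ * _)%:E.
  rewrite (eq_bigr (fun=> p)) ?prodr_const// => i iS.
  by rewrite iS.
rewrite (eq_bigr (fun=> 1 - p)); last by move=> i /negbTE ->.
have -> : (t - #|S| = #|[predC S]|)%N.
  by have := cardC S; rewrite card_ord; lia.
rewrite -prodr_const.
by apply: eq_bigl => i; rewrite !inE.
Qed.

(** By independence a set S of voters occurs with probability
    p^|S| (1-p)^(t-|S|), and C(t, k) sets have k elements. *)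
Lemma prob_majority t :
  P [set w | (t < (\sum_(i < t) `[< A (xi i w) >]).*2)%N] = (majority t p)%:E.
Proof.
have -> : [set w | (t < (\sum_(i < t) `[< A (xi i w) >]).*2)%N] =
    \bigcup_(S in [set` (fun S : {set 'I_t} => (t < #|S|.*2)%N)])
      (votes t @^-1` [set S]).
  have card w : #|votes t w| = (\sum_(i < t) `[< A (xi i w) >])%N.
    rewrite -sum1_card big_mkcond/=; apply: eq_bigr => i _.
    by rewrite inE; case: asboolP.
  apply/seteqP; split => w /=.
    by rewrite -card => tw; exists (votes t w).
  by move=> [S /= tS vS]; rewrite -card vS.
rewrite measure_fin_bigcup//=.
- rewrite -(bigfs _ (index_enum_uniq _))//; last first.
    by move=> S _; rewrite mem_index_enum.
  rewrite (eq_bigr (fun S : {set 'I_t} =>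
    (p ^+ #|S| * (1 - p) ^+ (t - #|S|))%:E)); last first.
    by move=> S _; exact: prob_votes.
  rewrite sumEFin; congr EFin.
  have cardS (S : {set 'I_t}) : (#|S| < t.+1)%N.
    by rewrite ltnS -[leqRHS](card_ord t) max_card.
  rewrite (partition_big (fun S : {set 'I_t} => Ordinal (cardS S))
    (fun k : 'I_t.+1 => (t < k.*2)%N))//=.
  rewrite /majority; apply: eq_bigr => k tk.
  rewrite (eq_bigr (fun=> p ^+ k * (1 - p) ^+ (t - k))); last first.
    by move=> S /andP[_ /eqP <-].
  rewrite sumr_const mulr_natl; congr (_ *+ _).
  rewrite -[X in 'C(X, _)]card_ord -card_draws.
  apply: eq_card => S; rewrite inE unfold_in -val_eqE/=.
  by case: (@eqP _ #|S|) => [->|]; rewrite ?tk ?andbF.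
- by move=> S S' _ _ [w [/= -> ->]].
- move=> S _; rewrite votesE; apply: fin_bigcap_measurable => // i _.
  by rewrite -[X in measurable X]setTI; apply: measurable_funP.
Qed.

End vote_count.

(** * The expected error as an integral over the test points *)

Section expected_error.
Context {dO dX dE : measure_display} {Omega : measurableType dO}
  {SX : measurableType dX} {E : measurableType dE} {R : realType}.
Variables (P : probability Omega R) (xi : nat -> {mfun Omega >-> E}).
Hypothesis xi_iid : iid P xi.
Variable h : SX -> E -> bool.
Hypothesis mh : measurable_fun [set: SX * E] (fun z => h z.1 z.2).
Variable Q : nat -> SX -> Omega -> bool.
Hypothesis QE : forall i x w, Q i x w = h x (xi i w).

Let accept x : set E := [set e | h x e].

Let measurable_accept x : measurable (accept x).
Proof.
have := measurableT_comp mh (pair1_measurable x).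
by move=> /(_ measurableT [set true]); rewrite setTI; exact.
Qed.

Let measurable_Q i :
  measurable_fun [set: SX * Omega] (fun z => Q i z.1 z.2).
Proof.
have -> : (fun z : SX * Omega => Q i z.1 z.2) =
    (fun z : SX * E => h z.1 z.2) \o (fun z : SX * Omega => (z.1, xi i z.2)).
  by apply/funext => z /=; rewrite QE.
apply: measurableT_comp mh _.
apply: measurable_fun_pair; first exact: measurable_fst.
exact: measurableT_comp.
Qed.

Lemma thetaE x : theta P Q x = fine (P (xi 0%N @^-1` accept x)).
Proof.
rewrite /theta; congr fine.
have -> : (fun w => (Q 0 x w)%:R : R) = \1_(xi 0%N @^-1` accept x).
  apply/funext => w; rewrite indicE QE.
  by rewrite (_ : (w \in _) = h x (xi 0%N w))//; apply/idP/idP; rewrite inE.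
rewrite expectation_indic//.
by rewrite -[X in measurable X]setTI; apply: measurable_funP.
Qed.

Lemma theta01 x : 0 <= theta P Q x <= 1.
Proof.
have mS : measurable (xi 0%N @^-1` accept x).
  by rewrite -[X in measurable X]setTI; apply: measurable_funP.
rewrite thetaE -!lee_fin fineK ?fin_num_measure//.
by rewrite measure_ge0 probability_le1.
Qed.

Lemma measurable_theta : measurable_fun [set: SX] (theta P Q).
Proof.
have mB : measurable [set z : SX * Omega | Q 0 z.1 z.2].
  by have /(_ measurableT [set true]) := measurable_Q 0; rewrite setTI; exact.
have -> : theta P Q = fun x => fine (P (xsection [set z | Q 0 z.1 z.2] x)).
  apply/funext => x; rewrite thetaE; congr (fine (P _)).
  by apply/seteqP; split => w; rewrite /xsection/= inE/= QE.
by apply: measurableT_comp => //; exact: (measurable_fun_xsection P).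
Qed.

(** The error event on the product of the sample space and the randomness of the
    classifiers: [Err] integrates its indicator over the first factor only. *)
Definition misclassified (t : nat) (l : bool) : set (SX * Omega) :=
  [set z | 1 / 2 <= `|Qbar Q t z.1 z.2 - l%:R : R|].

Lemma measurable_misclassified t (l : bool) : measurable (misclassified t l).
Proof.
have mf : measurable_fun [set: SX * Omega]
    (fun z => `|Qbar Q t z.1 z.2 - l%:R : R|).
  apply: measurableT_comp => //; apply: measurable_funB => //.
  apply: measurable_funM => //; apply: measurable_sum => i.
  apply: (@measurableT_comp _ _ _ _ _ _ (fun b : bool => b%:R : R)) => //.
have /(_ measurableT `[1 / 2, +oo[%classic (measurable_itv _)) := mf.
rewrite setTI (_ : _ @^-1` _ = misclassified t l)//.
by apply/seteqP; split => z /=; rewrite in_itv/= andbT.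
Qed.

(** The vote is at distance at least 1/2 from the label exactly when the majority
    differs from it, since t is odd. *)
Lemma misclassifiedE t (l : bool) x w : odd t ->
  (1 / 2 <= `|Qbar Q t x w - l%:R : R|) =
  (l (+) (t < (\sum_(i < t) `[< accept x (xi i w) >]).*2)%N).
Proof.
move=> ot; rewrite /Qbar; set N := (\sum_(i < t) _)%N.
have -> : \sum_(i < t) (Q i x w)%:R = N%:R :> R.
  rewrite natr_sum; apply: eq_bigr => i _.
  by rewrite QE asboolb.
have Nt : (N <= t)%N.
  rewrite /N -[leqRHS]card_ord -sum1_card; apply: leq_sum => i _.
  exact: leq_b1.
have t0 : 0 < t%:R :> R by rewrite ltr0n; case: (t) ot.
have -> : t%:R^-1 * N%:R = N%:R / t%:R :> R by rewrite mulrC.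
have NtR : N%:R / t%:R <= 1 :> R by rewrite ler_pdivrMr// mul1r ler_nat.
case: l => /=.
  rewrite ler0_norm ?subr_le0// opprB lerBrDr addrC -lerBrDr.
  have -> : 1 - 1 / 2 = 2^-1 :> R by field.
  rewrite ler_pdivrMr// mulrC ler_pdivlMr// -natrM ler_nat; lia.
rewrite subr0 ger0_norm; last by rewrite divr_ge0.
by rewrite ler_pdivlMr// mul1r mulrC ler_pdivrMr// -natrM ler_nat; lia.
Qed.

Lemma prob_misclassified t (l : bool) x : odd t ->
  P (xsection (misclassified t l) x) =
  (if l then 1 - majority t (theta P Q x) else majority t (theta P Q x))%:E.
Proof.
move=> ot; rewrite thetaE.
set V := [set w | (t < (\sum_(i < t) `[< accept x (xi i w) >]).*2)%N].
have PV : P V = (majority t (fine (P (xi 0%N @^-1` accept x))))%:E.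
  exact: prob_majority.
have sE : xsection (misclassified t l) x = if l then ~` V else V.
  apply/seteqP; split => w;
    rewrite /xsection/= inE /misclassified/= misclassifiedE//.
    by case: l => //= /negP.
  by case: l => //= /negP.
rewrite sE; case: l sE => // sE.
rewrite probability_setC ?PV ?EFinB//.
rewrite -[V]setCK -sE; apply: measurableC; apply: measurable_xsection.
exact: measurable_misclassified.
Qed.

(** After Fubini the test point is fixed first, and its votes are then i.i.d. *)
Lemma expected_Err (mu : {finite_measure set SX -> \bar R}) t (l : bool) :
  odd t ->
  ('E_P[Err Q mu t l] =
   \int[mu]_x (if l then 1 - majority t (theta P Q x)
               else majority t (theta P Q x))%:E)%E.
Proof.
move=> ot.
have mB := measurable_misclassified t l.
transitivity (\int[P]_w \int[mu]_x (\1_(misclassified t l) (x, w))%:E)%E.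
  rewrite unlock; apply: eq_integral => w _.
  have -> : (fun x => (\1_(misclassified t l) (x, w))%:E : \bar R) =
            (fun x => (\1_(ysection (misclassified t l) w) x)%:E).
    by apply/funext => x; rewrite !indicE mem_ysection.
  rewrite /Err (_ : [set x | _] = ysection (misclassified t l) w); last first.
    by apply/seteqP; split => x; rewrite /ysection/= inE.
  have mw : measurable (ysection (misclassified t l) w).
    exact: measurable_ysection.
  rewrite /Rintegral fineK// integral_indic// setIT.
  exact: fin_num_measure.
transitivity (\int[mu]_x \int[P]_w (\1_(misclassified t l) (x, w))%:E)%E.
  exact/esym/(indic_fubini_tonelli mu P mB).
apply: eq_integral => x _.
rewrite -prob_misclassified//.
by have := indic_fubini_tonelli_FE P mB; move=> /(congr1 (fun f => f x)).
Qed.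

End expected_error.

(** * Integration against a density *)

Section density.
Context {R : realType}.
Notation mu := (@lebesgue_measure R).
Local Notation I01 := `[(0 : R), 1]%classic.

(** The density is almost everywhere the Radon-Nikodym derivative. *)
Lemma integral_density
    (nu : {finite_measure set (measurableTypeR R) -> \bar R})
    (f phi : R -> R) (M : R) : has_density_on_unit_interval nu f ->
  measurable_fun [set: R] phi -> (forall s, `|phi s| <= M) ->
  (\int[nu]_s (phi s)%:E = \int[mu]_(s in I01) (phi s * f s)%:E)%E.
Proof.
move=> [mf f0 nuE] mphi phiM.
have mf1 : measurable_fun I01 (EFin \o f) by exact/measurable_EFinP.
have numu : nu `<< mu.
  apply/null_content_dominatesP => A mA muA; rewrite nuE// null_set_integral//.
  - exact: measurableI.
  - by apply: measurable_funS mf1 => //; exact: subIsetr.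
  - apply/eqP; rewrite eq_le measure_ge0 andbT -[leRHS]muA.
    by apply: le_measure; rewrite ?inE//; exact: measurableI.
have mf01 : measurable_fun setT ((EFin \o f) \_ I01).
  by apply/measurable_restrict => //; rewrite setTI.
have Iphi : nu.-integrable setT (EFin \o phi).
  apply: measurable_bounded_integrable => //.
    by rewrite ltey_eq fin_num_measure.
  exists M; split; first exact: num_real.
  by move=> x Mx s _; apply: le_trans (phiM s) _; exact: ltW.
rewrite -(Radon_Nikodym_change_of_variables numu)//.
rewrite [RHS](_ : _ =
    \int[mu]_s ((phi s)%:E * ((EFin \o f) \_ I01) s))%E; last first.
  rewrite [LHS]integral_mkcond; apply: eq_integral => s _.
  by rewrite !patchE; case: ifP => _ /=; rewrite ?mule0 ?EFinM.
have IRN : mu.-integrable setT (Radon_Nikodym (charge_of_finite_measure nu) mu).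
  exact: Radon_Nikodym_integrable.
apply: ae_eq_integral => //.
- apply: emeasurable_funM; first exact/measurable_EFinP.
  exact: (measurable_int mu).
- by apply: emeasurable_funM => //; exact/measurable_EFinP.
- apply: ae_eqe_mul2l; apply: integral_ae_eq => // A _ mA.
  rewrite -Radon_Nikodym_integral//=.
  by rewrite -integral_mkcondr; exact: nuE.
Qed.

End density.

Section cond_law_finite.
Context {dO dT : measure_display} {Omega : measurableType dO}
  {T : measurableType dT} {R : realType} (P : probability Omega R)
  (Y : {mfun Omega >-> bool}) (l : bool) (Z : {mfun Omega >-> T}).

Let mYl : measurable (Y @^-1` [set l]).
Proof. by rewrite -[X in measurable X]setTI; exact: measurable_funP. Qed.

Let cond_law_fin_num : fin_num_fun (cond_law P Y l Z).
Proof.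
move=> A mA; rewrite /cond_law fin_numM// fin_num_measure//.
apply: measurableI => //.
by rewrite -[X in measurable X]setTI; exact: measurable_funP.
Qed.

HB.instance Definition _ := @Measure_isFinite.Build _ _ _ (cond_law P Y l Z)
  cond_law_fin_num.

Lemma cond_law_setT : (0 < P (Y @^-1` [set l]))%E ->
  cond_law P Y l Z setT = 1%E.
Proof.
move=> Pl; rewrite /cond_law preimage_setT setTI.
have Pfin : P (Y @^-1` [set l]) \is a fin_num by exact: fin_num_measure.
rewrite -[X in (_ * X)%E]fineK// -EFinM mulVf//.
by rewrite gt_eqF// -lte_fin fineK.
Qed.

End cond_law_finite.

Section density_half.
Context {R : realType}.
Notation mu := (@lebesgue_measure R).
Local Notation I01 := `[(0 : R), 1]%classic.

Lemma integrable_density (nu : set R -> \bar R) f :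
  has_density_on_unit_interval nu f -> nu setT \is a fin_num ->
  mu.-integrable I01 (EFin \o f).
Proof.
move=> [mf f0 nuE] nufin; apply/integrableP; split.
  exact/measurable_EFinP.
have -> : (\int[mu]_(s in I01) `|(EFin \o f) s| =
           \int[mu]_(s in I01) (f s)%:E)%E.
  apply: eq_integral => s; rewrite inE/= in_itv/= => s01.
  by rewrite ger0_norm// f0.
by rewrite -[X in integral _ X]setTI -nuE// ltey_eq nufin.
Qed.

Lemma Rintegral_density (nu : set R -> \bar R) f :
  has_density_on_unit_interval nu f ->
  \int[mu]_(s in I01) f s = fine (nu setT).
Proof. by move=> [_ _ nuE]; rewrite nuE// setTI. Qed.

Lemma cdf_of_density_half f : mu.-integrable I01 (EFin \o f) ->
  cdf_of_density f (1 / 2) =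
  \int[mu]_(s in I01) f s - \int[mu]_(s in `[1 / 2, 1]) f s.
Proof.
move=> If; rewrite -Rintegral_above_half// -RintegralB//; last first.
  exact: integrable_above_half_mul.
rewrite /cdf_of_density Rintegral_mkcondl; apply: eq_Rintegral => s _.
rewrite patchE mem_setE in_itv/= leNgt.
by case: (1 / 2 < s); rewrite ?mul1r ?mul0r ?subrr ?subr0.
Qed.

End density_half.

(** * First-order behaviour of the deviation *)

Section rate.
Context {R : realType}.
Notation mu := (@lebesgue_measure R).
Local Notation I01 := `[(0 : R), 1]%classic.

(** The constant C gathers what is of order 1/t^2: the contribution of the
    points far from 1/2, and c times the difference of 1/(8t) and 1/(8(t+2)). *)
Lemma deviation_rate f (c k : R) : 0 <= k ->
  mu.-integrable I01 (EFin \o f) ->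
  (\forall s \near (1 / 2 : R),
     `|f s - f (1 / 2) - c * (s - 1 / 2)| <= k * `|s - 1 / 2|) ->
  exists2 C : R, 0 <= C & forall t, odd t ->
    `|\int[mu]_(s in I01) (deviation t s * f s) + c * (8 * t%:R)^-1| <=
    (k + C / t%:R) * t%:R^-1.
Proof.
move=> k0 If /nbhs_ballP[e /= e0 near_half].
(* The open ball of radius e contains the closed one of radius d. *)
pose d := e / 2; have d0 : 0 < d by rewrite divr_gt0.
pose J := \int[mu]_(s in I01) `|f s - f (1 / 2) - c * (s - 1 / 2)|.
have J0 : 0 <= J by apply: Rintegral_ge0.
exists (2 / d ^+ 4 * J + `|c|) => [|t ot].
  by rewrite addr_ge0// mulr_ge0// divr_ge0// exprn_ge0// ltW.
have := @Rintegral_deviation_approx _ t f c k d ot k0 d0 If.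
have near_d s : 0 <= s <= 1 -> `|s - 1 / 2| <= d ->
    `|f s - f (1 / 2) - c * (s - 1 / 2)| <= k * `|s - 1 / 2|.
  move=> _ sd; apply: near_half; rewrite /ball/= distrC.
  by apply: le_lt_trans sd _; rewrite /d; lra.
move=> /(_ near_d); rewrite -/J.
have t1 : 1 <= t%:R :> R by rewrite ler1n; case: (t) ot.
have t0 : 0 < t%:R :> R by lra.
set I := \int[mu]_(s in I01) _ => IJ.
have -> : I + c * (8 * t%:R)^-1 = (I + c * (8 * (t%:R + 2))^-1) +
    c * ((8 * t%:R)^-1 - (8 * (t%:R + 2))^-1) by ring.
apply: (le_trans (ler_normD _ _)); rewrite normrM.
have -> : (k + (2 / d ^+ 4 * J + `|c|) / t%:R) / t%:R =
    (k / t%:R + 2 / (t%:R * d ^+ 2) ^+ 2 * J) + `|c| / t%:R ^+ 2.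
  by field; rewrite !gt_eqF.
rewrite lerD//.
  apply: (le_trans IJ); rewrite lerD2r ler_wpM2l// lef_pV2 ?posrE; lra.
rewrite ler_wpM2l//.
have -> : (8 * t%:R)^-1 - (8 * (t%:R + 2))^-1 =
    (4 * (t%:R * (t%:R + 2)))^-1 :> R.
  by field; rewrite !gt_eqF//; lra.
rewrite ger0_norm ?invr_ge0; last by rewrite !mulr_ge0//; lra.
by rewrite lef_pV2 ?posrE ?exprn_gt0//; nra.
Qed.

Lemma lipschitz_near_half_near f : lipschitz_near_half f ->
  exists2 k : R, 0 <= k & \forall s \near (1 / 2 : R),
    `|f s - f (1 / 2) - 0 * (s - 1 / 2)| <= k * `|s - 1 / 2|.
Proof.
move=> [k [d [k0 d0 fk]]]; exists k; first exact: ltW.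
apply/nbhs_ballP; exists d => //= s; rewrite /ball/= ltr_distl => /andP[s1 s2].
by rewrite mul0r subr0; apply: fk; rewrite in_itv/=; lra.
Qed.

Lemma derivable_near (f : R -> R) (a e : R) : derivable f a 1 -> 0 < e ->
  \forall s \near a, `|f s - f a - derive1 f a * (s - a)| <= e * `|s - a|.
Proof.
move=> /derivable_nbhs/eqaddoP fa e0; have /nbhs_ballP[d /= d0 H] := fa e e0.
apply/nbhs_ballP; exists d => //= s; rewrite /ball/= => sd.
have : ball (0 : R) d (s - a) by rewrite /ball/= sub0r normrN distrC.
move=> /H /=; rewrite !fctE/= /cst [(s - a)%:A]mulr1 subrK opprD addrA.
by rewrite derive1E -[(s - a) *: _]/((s - a) * _) (mulrC (s - a)).
Qed.

End rate.

(** * The expected error in terms of the deviation *)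

Section error_deviation.
Context {dO dX dE : measure_display} {Omega : measurableType dO}
  {SX : measurableType dX} {E : measurableType dE} {R : realType}.
Notation mu := (@lebesgue_measure R).
Local Notation I01 := `[(0 : R), 1]%classic.
Variables (P : probability Omega R) (xi : nat -> {mfun Omega >-> E}).
Hypothesis xi_iid : iid P xi.
Variable h : SX -> E -> bool.
Hypothesis mh : measurable_fun [set: SX * E] (fun z => h z.1 z.2).
Variable Q : nat -> SX -> Omega -> bool.
Hypothesis QE : forall i x w, Q i x w = h x (xi i w).
Variables (X : {mfun Omega >-> SX}) (Y : {mfun Omega >-> bool}).

Let measurable_theta_X :
  @measurable_fun _ _ Omega (measurableTypeR R) setT (theta P Q \o X).
Proof. by apply: measurableT_comp => //; exact: (measurable_theta P mh QE). Qed.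

(** The law of theta(X) is the image by theta of the law of X. The bounds on phi
    are assumed on the whole line because the change of variables goes through
    an integral of phi over it. *)
Lemma integral_theta (f phi : R -> R) (l : bool) (M : R) :
  has_density_on_unit_interval (cond_law P Y l (theta P Q \o X)) f ->
  measurable_fun [set: R] phi -> (forall s, 0 <= phi s <= M) ->
  (\int[cond_law P Y l X]_x (phi (theta P Q x))%:E =
   \int[mu]_(s in I01) (phi s * f s)%:E)%E.
Proof.
move=> fd mphi phiM.
pose Z : {mfun Omega >-> measurableTypeR R} :=
  @mfun_Sub _ _ Omega (measurableTypeR R) _ (mem_set measurable_theta_X).
have phiE : measurable_fun [set: measurableTypeR R] (EFin \o phi).
  exact/measurable_EFinP.
have mtheta : @measurable_fun _ _ SX (measurableTypeR R) setT (theta P Q).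
  exact: (measurable_theta P mh QE).
have phi0 : {in [set: measurableTypeR R], forall s, (0 <= (EFin \o phi) s)%E}.
  by move=> s _; rewrite lee_fin; have /andP[] := phiM s.
have <- := @integral_density _ (cond_law P Y l Z) f phi M fd mphi.
  have := ge0_integral_pushforward mtheta (cond_law P Y l X) measurableT
    phiE phi0.
  rewrite preimage_setT => <-.
  by apply: eq_measure_integral => A mA _.
by move=> s; have /andP[? ?] := phiM s; rewrite ger0_norm.
Qed.

(** In class 0 the integral of b_t f exceeds that of 1{s > 1/2} f, which is
    1 - F(1/2), by the integral of D_t f; class 1 is the complement. *)
Lemma expected_Err_deviation (f : bool -> R -> R) (l : bool) t : odd t ->
  (forall l', 0 < P (Y @^-1` [set l']))%E ->
  (forall l', has_density_on_unit_interval
    (cond_law P Y l' (theta P Q \o X)) (f l')) ->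
  fine 'E_P[Err Q (cond_law P Y l X) t l] = err_infty f l +
    (-1) ^+ l * \int[mu]_(s in I01) (deviation t s * f l s).
Proof.
move=> ot Ypos fd.
have law1 : cond_law P Y l (theta P Q \o X) setT = 1%E.
  exact: (cond_law_setT X (Ypos l)).
have If : mu.-integrable I01 (EFin \o f l).
  by apply: integrable_density (fd l) _; rewrite law1.
have f1 : \int[mu]_(s in I01) f l s = 1.
  by rewrite (Rintegral_density (fd l)) law1.
have Im := integrable_majority_mul ot If.
have vote01 (s : R) : 0 <= s <= 1 ->
    0 <= (if l then 1 - majority t s else majority t s) <= 1.
  move=> s01; have := majority_ge0 t s01; have := majority_le1 ot s01.
  by case: (l) => ? ?; lra.
(* The polynomials b_t and 1 - b_t are unbounded on the line, hence the cutoff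
   outside [0, 1], where theta takes no value. *)
pose phi (s : R) : R := if (0 <= s <= 1) then
  (if l then 1 - majority t s else majority t s) else 0.
have phiM s : 0 <= phi s <= 1.
  rewrite /phi; case: ifP => [/vote01//|_]; lra.
have mphi : measurable_fun [set: R] phi.
  apply: measurable_fun_ifT => //.
    by apply: measurable_and; exact: measurable_fun_ler.
  case: (l); last exact: measurable_majority.
  by apply: measurable_funB => //; exact: measurable_majority.
rewrite (expected_Err xi_iid mh QE)//.
rewrite (eq_integral (fun x => (phi (theta P Q x))%:E)); last first.
  by move=> x _; rewrite /phi (theta01 P mh QE).
rewrite (integral_theta (fd l) mphi phiM) -/(Rintegral _ _ _).
rewrite Rintegral_deviation_mul//.
have -> : \int[mu]_(s in I01) (phi s * f l s) =
    if l then 1 - \int[mu]_(s in I01) (majority t s * f l s)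
    else \int[mu]_(s in I01) (majority t s * f l s).
  case: (l) If f1 Im @phi {phiM mphi} => If f1 Im phi.
    rewrite -[X in _ = X - _]f1 -RintegralB//; apply: eq_Rintegral => s.
    by rewrite inE/= in_itv/= /phi => ->; rewrite mulrBl mul1r.
  by apply: eq_Rintegral => s; rewrite inE/= in_itv/= /phi => ->.
rewrite /err_infty; case: (l) If f1 => If f1.
  by rewrite cdf_of_density_half// f1; ring.
by rewrite cdf_of_density_half// f1; ring.
Qed.

End error_deviation.

(** * The asymptotic expansion *)

Lemma near_odd_infty (A : nat -> Prop) (n : nat) :
  (forall t, odd t -> (n <= t)%N -> A t) -> \forall t \near odd_infty, A t.
Proof. by move=> nA; exists n => // t /= nt ot; exact: nA. Qed.

Theorem lemma1 (R : realType)
    (dO dX dE : measure_display)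
    (Omega : measurableType dO) (SX : measurableType dX) (E : measurableType dE)
    (P : probability Omega R)
    (n : nat) (D : n.-tuple (SX * bool))
    (X : {RV P >-> SX}) (Y : {RV P >-> bool}) (xi : nat -> {RV P >-> E})
    (g : SX -> n.-tuple (SX * bool) -> E -> bool)
    (Q : nat -> SX -> Omega -> bool)
    (f : bool -> R -> R) (l : bool)
    (g_meas : measurable_fun [set: SX * E] (fun p => g p.1 D p.2))
    (Q_form : forall i x w, Q i x w = g x D (xi i w))
    (xi_iid : iid P xi)
    (XY_xi_indep : independent_of_sequence P (fun w => (X w, Y w)) xi)
    (Y_pos : forall l' : bool, (0 < P (Y @^-1` [set l']))%E)
    (f_density : forall l' : bool,
      has_density_on_unit_interval (cond_law P Y l' (theta P Q \o X)) (f l'))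
    (f_lip : forall l' : bool, lipschitz_near_half (f l')) :
  (fun t : nat => fine 'E_P[Err Q (cond_law P Y l X) t l])
    = (fun t : nat => err_infty f l)
      +O_odd_infty (fun t : nat => t%:R^-1 : R) /\
  (derivable (f l) (1 / 2) 1 ->
   (fun t : nat => fine 'E_P[Err Q (cond_law P Y l X) t l])
     = (fun t : nat =>
          err_infty f l + (-1) ^+ l.+1 * ((8 * t%:R)^-1 * derive1 (f l) (1 / 2)))
       +o_odd_infty (fun t : nat => t%:R^-1 : R)).
Proof.
have mg : measurable_fun [set: SX * E] (fun z => g z.1 D z.2) by [].
pose I t : R := \int[lebesgue_measure]_(s in `[0, 1]) (deviation t s * f l s).
have errE t : odd t -> fine 'E_P[Err Q (cond_law P Y l X) t l] =
    err_infty f l + (-1) ^+ l * I t.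
  move=> ot.
  exact: (expected_Err_deviation xi_iid (h := fun x e => g x D e)).
have sgn b : `|(-1) ^+ (b : bool) : R| = 1 by rewrite normrX normrN1 expr1n.
have If : lebesgue_measure.-integrable `[(0 : R), 1] (EFin \o f l).
  apply: integrable_density (f_density l) _.
  rewrite [X in X \is a fin_num](_ : _ = 1%E)//.
  exact: (cond_law_setT X (Y_pos l)).
split.
  have [k k0 lip] := lipschitz_near_half_near (f_lip l).
  have [C C0 IC] := deviation_rate k0 If lip.
  apply/eqaddOP; near=> K; apply: (@near_odd_infty _ 0) => t ot _.
  rewrite !fctE errE// addrAC subrr add0r normrM sgn mul1r.
  have t1 : 1 <= t%:R :> R by rewrite ler1n; case: (t) ot.
  rewrite [X in _ <= _ * X]ger0_norm ?invr_ge0//.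
  apply: (@le_trans _ _ ((k + C / t%:R) * t%:R^-1)).
    by have := IC t ot; rewrite mul0r addr0.
  rewrite ler_wpM2r ?invr_ge0//.
  apply: (@le_trans _ _ (k + C)); last by near: K; exact: nbhs_pinfty_ge.
  by rewrite lerD2l ler_pdivrMr; nra.
move=> df; apply/eqaddoP => e e0.
have e2 : 0 < e / 2 by rewrite divr_gt0.
have [C C0 IC] := deviation_rate (ltW e2) If (derivable_near df e2).
(* Half of e absorbs the first-order remainder, and C / t is below the other
   half as soon as t exceeds 2 C / e. *)
apply: (@near_odd_infty _ (Num.truncn (2 * C / e)).+1) => t ot Ct.
have t1 : 1 <= t%:R :> R by rewrite ler1n; case: (t) ot.
rewrite !fctE errE//.
have -> : err_infty f l + (-1) ^+ l * I t - (err_infty f l +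
    (-1) ^+ l.+1 * ((8 * t%:R)^-1 * derive1 (f l) (1 / 2))) =
    (-1) ^+ l * (I t + derive1 (f l) (1 / 2) * (8 * t%:R)^-1).
  by rewrite exprS; ring.
rewrite normrM sgn [leLHS]mul1r [X in _ <= _ * X]ger0_norm ?invr_ge0//.
apply: (le_trans (IC t ot)); rewrite ler_wpM2r ?invr_ge0//.
have Ce : 2 * C / e < t%:R.
  by apply: lt_le_trans (truncnS_gt _) _; rewrite ler_nat.
have : C / t%:R <= e / 2.
  move: Ce; rewrite ltr_pdivrMr// => Ce.
  by rewrite ler_pdivrMr; nra.
by lra.
Unshelve. all: by end_near. Qed.
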